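(* If $\pi\in\mathfrak{S}_{2,n}$ is chosen uniformly at random and $\mathcal{L}_2^1:=\lim_{n\to\infty}\mathbb{E}[L^1_{2,n}(\pi)]$, then $$\mathcal{L}_2^1=e\left(\cos(1)+\sin(1)\right)-1.$$
   Context: $\mathfrak{S}_{2,n}$ is the set of words $\pi$ of length $2n$ which use each integer in $[n]=\{1,\ldots,n\}$ exactly $2$ times. For $\pi\in\mathfrak{S}_{2,n}$, $L^1_{2,n}(\pi)$ is the length of the longest (not necessarily contiguous) subsequence of $\pi$ of the form $1\,2\,3\cdots j$. *)

(* Defs.v *)
From HB Require Import structures.
From mathcomp Require Import all_boot all_order all_algebra.
From mathcomp Require Import all_classical all_reals all_analysis.

Set Implicit Arguments.
Unset Strict Implicit.
Unset Printing Implicit Defensive.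

Import Order.TTheory GRing.Theory Num.Theory.
Import numFieldNormedType.Exports.

Local Open Scope ring_scope.

                                                                           
                                         
Definition letters (n : nat) (w : (2 * n).-tuple 'I_n) : seq nat :=
  [seq (nat_of_ord i).+1 | i <- w].

Definition words2 (n : nat) : {set (2 * n).-tuple 'I_n} :=
  [set w : (2 * n).-tuple 'I_n | [forall i : 'I_n, count_mem i w == 2%N]].

                                                                        
                                          
Definition longest_initial_run (s : seq nat) : nat :=
  \max_(j < (size s).+1 | subseq (iota 1 j) s) j.

Definition L12 (n : nat) (w : (2 * n).-tuple 'I_n) : nat :=
  longest_initial_run (letters w).

Definition uniform_expectation (R : realType) (T : finType) (A : {set T})
    (X : T -> R) : R :=
  (\sum_(x in A) X x) / #|A|%:R.

Definition expected_L12 (R : realType) (n : nat) : R :=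
  uniform_expectation (words2 n) (fun w => (L12 w)%:R).

(* Main.v *)
Require Import Defs.
From HB Require Import structures.
From mathcomp Require Import all_boot all_order all_algebra.
From mathcomp Require Import all_classical all_reals all_analysis.
From mathcomp Require Import zify ring lra.

Import Order.TTheory GRing.Theory Num.Theory.
Import numFieldNormedType.Exports.

Local Open Scope classical_set_scope.
Local Open Scope ring_scope.

(** The expectation is the sum over [j >= 1] of the probability that a random
    word contains [1 2 ... j] as a subsequence, because [L >= j] says exactly
    that. Three ideas evaluate this sum.

    A signed count of occurrences (lemma [sum_occurrences_doublings]). Write
    [N(s, w)] for the number of ways [s] occurs in [w] as a subsequence. Given
    a pattern [t], let [s] range over the patterns obtained from [t] by writing
    each letter once or twice in a row, with sign [-1] for each doubled letter.
    If no letter appears more than twice in [w], the signed sum of the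
    [N(s, w)] is [1] when [t] is a subsequence of [w] and [0] otherwise: it
    counts the leftmost embedding of [t] alone, a doubled letter cancelling the
    embeddings that pass over a usable copy of that letter.

    Linearity. Averaged over all words of a given content, [N(s, w)] depends
    only on the length of [s] and on multiplicities: there are
    [C(2n, |s|)] choices of positions, and the remaining letters are arranged
    freely ([sum_occurrences_permutations]). With two copies of each letter the
    average of [N(s, w)] is [2 ^ j / |s|!] for each [s] coming from a pattern of
    length [j], whatever [n] is. So the probability for [j] is
    [p_j = 2 ^ j * sum_k (-1) ^ k C(j, k) / (j + k)!], written below as
    [2 ^ j] times the [j]-th iterate at [0] of
    [Delta f m = f (m + 1) - f (m + 2)] on [m |-> 1 / m!].

    Summation over [j]. Let [G_m] be the [m]-fold primitive, vanishing to order
    [m] at [0], of [G_0 u = e ^ u (cos u + sin u)]. As [G_0] solves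
    [y'' = 2 y' - 2 y] with [y 0 = 1] and [y' 0 = 2], integrating gives
    [G_m 1 = 1 / m! + 2 (Delta G) m 1]. Iterating this identity from [m = 0]
    yields [e (cos 1 + sin 1) = p_0 + ... + p_(n-1)] plus an error
    [2 ^ n (Delta^n G) 0 1] of size at most [2 e 4 ^ n / n!], which tends to
    [0]. The term [p_0 = 1] is not part of the expectation, whence the final
    [- 1]. *)

(** * Occurrences of a pattern in a word *)

Fixpoint occurrences {T : eqType} (s w : seq T) : nat :=
  match s, w with
  | [::], _ => 1
  | _ :: _, [::] => 0
  | x :: s', y :: w' => occurrences s w' + (x == y) * occurrences s' w'
  end.

Fixpoint doublings {T : Type} (t : seq T) : seq (seq T) :=
  if t is x :: t' then
    [seq x :: s | s <- doublings t'] ++ [seq x :: x :: s | s <- doublings t']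
  else [:: [::]].

Lemma occurrences_nil {T : eqType} (w : seq T) : occurrences [::] w = 1%N.
Proof. by case: w. Qed.

Lemma occurrences_eq0 {T : eqType} (x : T) (s w : seq T) :
  (count_mem x w < count_mem x s)%N -> occurrences s w = 0%N.
Proof.
elim: w s => [|y w IHw] [|z s] //= lt_ws; rewrite IHw /=; last by lia.
case: (eqVneq z y) lt_ws => [->|_] //= lt_ws; rewrite IHw //.
by rewrite ltn_add2l in lt_ws.
Qed.

Lemma count_doublings {T : eqType} (t s : seq T) (x : T) :
  s \in doublings t ->
  (count_mem x t <= count_mem x s <= 2 * count_mem x t)%N.
Proof.
elim: t s => [|y t IHt] s /=; first by rewrite inE => /eqP ->.
by rewrite mem_cat => /orP[] /mapP[s' /IHt + ->] /=; lia.
Qed.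

Lemma sum_doublings_cons {R : pzRingType} {T : Type} (x : T) (t : seq T)
    (F : seq T -> R) :
  \sum_(s <- doublings (x :: t)) (-1) ^+ (size s + size (x :: t)) * F s =
  \sum_(s <- doublings t)
     (-1) ^+ (size s + size t) * (F (x :: s) - F (x :: x :: s)).
Proof.
rewrite /= big_cat !big_map /=.
rewrite -big_split /=; apply: eq_bigr => s _.
by rewrite !(addSn, addnS) !exprS !mulN1r opprK mulrBr mulNr.
Qed.

(** Only the case of a word beginning with the first letter [x] of the pattern
    needs an argument. The occurrences using that copy of [x] once contribute
    the signed sum for the two tails. Those using it as the first half of a
    doubled [x] are the occurrences of [x s] in the tail, and they cancel
    against the occurrences that skip this copy; occurrences of a doubled [x]
    further on do not exist, since at most one [x] is left. *)
Lemma sum_occurrences_doublings {R : pzRingType} {T : eqType} (t w : seq T) :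
  (forall x, count_mem x w <= 2)%N ->
  \sum_(s <- doublings t) (-1) ^+ (size s + size t) * (occurrences s w)%:R =
  (subseq t w)%:R :> R.
Proof.
elim: t w => [|x t IHt] w.
  by rewrite big_seq1 occurrences_nil sub0seq mulr1.
elim: w => [|y w IHw] le2; rewrite sum_doublings_cons.
  by rewrite big1 // => s _ /=; rewrite subrr mulr0.
have le2w z : (count_mem z w <= 2)%N.
  by apply: leq_trans (le2 z); rewrite /= leq_addl.
rewrite /= [in RHS]eq_sym.
have [eq_xy|_] /= := eqVneq x y; last first.
  rewrite -IHw // sum_doublings_cons; apply: eq_bigr => s _ /=.
  by rewrite !mul0n !addn0.
rewrite -IHt //; apply: eq_bigr => s _; rewrite !mul1n.
have /= -> : occurrences [:: x, x & s] w = 0%N.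
  apply: (occurrences_eq0 x); have := le2 x.
  by rewrite /= -eq_xy !eqxx; lia.
by rewrite add0n natrD [X in X - _]addrC addrK.
Qed.

(** * Averaging occurrences over all words of a given content *)

(** Words are split according to their first letter; the counts below are
    inductions along this decomposition. *)
Lemma big_permutations_cons {V : Type} {idx : V} {op : Monoid.com_law idx}
    {T : eqType} (m : seq T) (F : seq T -> V) : (0 < size m)%N ->
  \big[op/idx]_(w <- permutations m) F w =
  \big[op/idx]_(x <- undup m)
    \big[op/idx]_(w <- permutations (rem x m)) F (x :: w).
Proof.
by move=> m_gt0; rewrite (perm_big _ (permutationsE m_gt0)) big_allpairs_dep.
Qed.

Lemma size_permutations_rem {T : eqType} (r : seq T) : (0 < size r)%N ->
  (\sum_(x <- undup r) size (permutations (rem x r)))%N =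
  size (permutations r).
Proof.
move=> r_gt0.
rewrite -[RHS]sum1_size big_permutations_cons //.
by apply: eq_bigr => x _; rewrite sum1_size.
Qed.

Lemma sum_undup_subset {T : eqType} (m r : seq T) (F : T -> nat) :
  {subset r <= m} ->
  (\sum_(x <- undup m) (x \in r) * F x)%N = (\sum_(x <- undup r) F x)%N.
Proof.
move=> sub.
rewrite (eq_bigr (fun x => if x \in r then F x else 0%N)); last first.
  by move=> x _; case: (x \in r); rewrite ?mul1n ?mul0n.
rewrite -big_mkcond -big_filter; apply: perm_big; apply: uniq_perm.
- exact/filter_uniq/undup_uniq.
- exact: undup_uniq.
- move=> x; rewrite mem_filter !mem_undup.
  by have [/sub ->|] := boolP (x \in r).
Qed.

(** Double counting of words with a marked occurrence of [s]: choose the marked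
    positions, then arrange the other letters [r] in the other positions. The
    induction on the first letter of the word turns this into Pascal's rule,
    according to whether the first position is marked. *)
Lemma sum_occurrences_permutations {T : eqType} (s r m : seq T) :
  perm_eq m (s ++ r) ->
  (\sum_(w <- permutations m) occurrences s w)%N =
  ('C(size m, size s) * size (permutations r))%N.
Proof.
move: {2}(size m) (erefl (size m)) => n.
elim: n s r m => [|n IHn] s r m sz_m eq_m.
  have /= := perm_size eq_m; rewrite size_cat sz_m.
  case: s eq_m => // ; case: r => // _ _.
  by rewrite (size0nil sz_m) big_seq1.
have m_gt0 : (0 < size m)%N by rewrite sz_m.
case: s eq_m => [|x s] eq_m.
  rewrite bin0 mul1n; under eq_bigr do rewrite occurrences_nil.
  by rewrite sum1_size; apply/perm_size/perm_permutations.
have sub_rm : {subset r <= m}.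
  by move=> y; rewrite (perm_mem eq_m) mem_cat => ->; rewrite orbT.
have m_x : x \in m by rewrite (perm_mem eq_m) inE eqxx.
have sz_rem y : y \in m -> size (rem y m) = n.
  by move=> my; rewrite size_rem // sz_m.
rewrite big_permutations_cons // /=.
under eq_bigr do rewrite big_split /=.
rewrite big_split /= sz_m binS mulnDl; congr (_ + _)%N; last first.
  rewrite (bigD1_seq x) ?undup_uniq ?mem_undup //= eqxx.
  rewrite [X in (_ + X)%N]big1 ?addn0; last first.
    by move=> y /negbTE; rewrite eq_sym => ->; rewrite big1 // => w _.
  under eq_bigr do rewrite mul1n.
  rewrite (IHn s r) ?sz_rem //.
  rewrite -(perm_cons x) -cat_cons; apply: perm_trans eq_m.
  by rewrite perm_sym perm_to_rem.
transitivity (\sum_(y <- undup m)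
    (y \in r) * ('C(n, (size s).+1) * size (permutations (rem y r))))%N.
  apply: eq_big_seq => y; rewrite mem_undup => my.
  have [ry|nry] := boolP (y \in r); last first.
    rewrite mul0n big1_seq // => w /= ; rewrite mem_permutations => eq_w.
    apply: (occurrences_eq0 y); rewrite (permP eq_w).
    have := permP (perm_to_rem my) (pred1 y); rewrite (permP eq_m).
    rewrite count_cat (count_memPn nry) /= eqxx; lia.
  rewrite mul1n (IHn (x :: s) (rem y r)) ?sz_rem //.
  rewrite -(perm_cons y) perm_sym.
  apply: perm_trans (perm_to_rem my); rewrite perm_sym.
  apply: perm_trans eq_m _.
  rewrite -[y :: _]cat1s perm_sym perm_catCA perm_cat2l perm_sym.
  exact: perm_to_rem.
rewrite sum_undup_subset // -big_distrr /=.
have [r_gt0|r0] := ltnP 0 (size r); first by rewrite size_permutations_rem.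
have : size m = (size s).+1.
  by rewrite (perm_size eq_m) size_cat /=; lia.
by rewrite sz_m => -[->]; rewrite bin_small.
Qed.

(** The multinomial coefficient. Indexing the product by a superset [A] of the
    letters lets contents with missing letters share one index set; the extra
    factors are [0! = 1]. *)
Lemma size_permutations_count {T : eqType} (A r : seq T) :
  uniq A -> {subset r <= A} ->
  (size (permutations r) * \prod_(x <- A) (count_mem x r)`!)%N = (size r)`!.
Proof.
move=> uniqA; move: {2}(size r) (erefl (size r)) => n.
elim: n r => [|n IHn] r sz_r sub_r.
  by rewrite (size0nil sz_r) mul1n big1.
rewrite -size_permutations_rem ?sz_r // big_distrl /= factS.
rewrite -{1}sz_r -[size r](sum1_size) big_distrl /=.
transitivity (\sum_(x <- undup r) count_mem x r * n`!)%N; last first.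
  rewrite -[RHS]big_undup_iterop_count; apply: eq_bigr => x _.
  by rewrite Monoid.iteropE iter_addn_0 mul1n mulnC.
apply: eq_big_seq => x; rewrite mem_undup => rx.
have sz_x : size (rem x r) = n by rewrite size_rem // sz_r.
rewrite -[X in X`!]sz_x -(IHn (rem x r)) //; last by move=> y /mem_rem/sub_r.
rewrite mulnCA; congr (_ * _)%N.
rewrite !(bigD1_seq x) ?sub_r //= mulnA.
have cnt y : count_mem y r = ((x == y) + count_mem y (rem x r))%N.
  by rewrite (permP (perm_to_rem rx)).
congr (_ * _)%N; first by rewrite cnt eqxx factS.
by apply: eq_bigr => y /negbTE; rewrite cnt eq_sym => ->.
Qed.

(** * The probability of containing a given pattern *)

(** One step of the signed sum over doublings, seen on functions of the length
    of the pattern: a letter written once minus a letter written twice. *)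
Definition Delta {R : pzRingType} (f : nat -> R) (m : nat) : R :=
  f m.+1 - f m.+2.

Lemma sum_doublings_size {R : pzRingType} {T : Type} (t : seq T)
    (f : nat -> R) :
  \sum_(s <- doublings t) (-1) ^+ (size s + size t) * f (size s) =
  iter (size t) Delta f 0.
Proof.
elim: t f => [|x t IHt] f; first by rewrite big_seq1 mul1r.
by rewrite (sum_doublings_cons x t (f \o size)) (IHt (Delta f)) -iterSr.
Qed.

(** Equal to [2 ^ j * sum_k (-1) ^ k C(j, k) / (j + k)!]. Not mentioning the
    size of the alphabet is the point: the expectation for [n] letters is then
    a partial sum of a fixed series. *)
Definition hit_probability (R : realType) (j : nat) : R :=
  2 ^+ j * iter j Delta (fun i => (i`!%:R)^-1) 0%N.

Lemma count_mem_subset {T : eqType} (A t : seq T) :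
  uniq A -> uniq t -> {subset t <= A} -> count (mem t) A = size t.
Proof.
move=> uA ut sub; rewrite -size_filter; apply: perm_size.
apply: uniq_perm; rewrite ?filter_uniq // => x; rewrite mem_filter.
by apply/andP/idP => [[]//|tx]; split=> //; exact: sub.
Qed.

(** Every doubling [s] of [t] has the same average number of occurrences up to
    the factor [1 / (size s)!]: a letter of [t] has at most one copy left once
    [s] is placed, so it contributes a trivial factorial to the multinomial
    coefficient of the rest, while each letter outside [t] contributes [2!]. *)
Lemma sum_occurrences_doubled {T : eqType} (A t s : seq T) :
  uniq A -> uniq t -> {subset t <= A} -> s \in doublings t ->
  ((\sum_(w <- permutations (A ++ A)) occurrences s w) * (size s)`! =
   2 ^ size t * size (permutations (A ++ A)))%N.
Proof.
move=> uA ut sub ds; set m := A ++ A.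
have cntm x : count_mem x m = (2 * (x \in A))%N.
  by rewrite count_cat !count_uniq_mem // mul2n addnn.
have cnts x : ((x \in t) <= count_mem x s <= 2 * (x \in t))%N.
  by have := count_doublings t s x ds; rewrite (count_uniq_mem x ut).
have [r eq_m] : {r | perm_eq m (s ++ r)}.
  have /count_subseqP/cid2[s' sub' eq_s] x : (count_mem x s <= count_mem x m)%N.
    have /andP[_] := cnts x; rewrite cntm => /leq_trans; apply.
    by rewrite leq_mul2l /=; case: (boolP (x \in t)) => // /sub ->.
  have [r eq_r] := perm_to_subseq sub'; exists r.
  by apply: perm_trans eq_r _; rewrite perm_cat2r perm_sym.
rewrite (sum_occurrences_permutations _ _ _ eq_m).
have sub_m : {subset m <= A} by move=> x; rewrite mem_cat orbb.
have sub_r : {subset r <= A}.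
  by move=> x rx; apply: sub_m; rewrite (perm_mem eq_m) mem_cat rx orbT.
have := size_permutations_count A m uA sub_m.
have := size_permutations_count A r uA sub_r.
have -> : (\prod_(x <- A) (count_mem x m)`! = 2 ^ size A)%N.
  rewrite (eq_big_seq (fun=> 2%N)) => [|x Ax]; last by rewrite cntm Ax.
  by rewrite big_const_seq count_predT -Monoid.iteropE.
have -> : (\prod_(x <- A) (count_mem x r)`! = 2 ^ count (predC (mem t)) A)%N.
  rewrite (eq_big_seq (fun x => if x \notin t then 2 else 1)%N) => [|x Ax].
    by rewrite -big_mkcond big_const_seq -Monoid.iteropE.
  have := cntm x; rewrite (permP eq_m) count_cat Ax => /= cnt2.
  have := cnts x.
  case: (x \in t) => /= le_s.
    have : (count_mem x r <= 1)%N by lia.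
    by case: (count_mem x r) => [|[]].
  by have -> : count_mem x r = 2%N by lia.
have szm : size m = (size s + size r)%N by rewrite (perm_size eq_m) size_cat.
have := bin_fact (leq_addr (size r) (size s)); rewrite addKn -szm.
rewrite -(count_predC (mem t) A) (count_mem_subset A t) // expnD.
(* [K] is the contribution [2!] of each letter outside [t]. *)
set K := (2 ^ count _ _)%N => binE rE mE.
have K_gt0 : (0 < K)%N by rewrite expn_gt0.
apply/eqP; rewrite -(eqn_pmul2r K_gt0) mulnAC -[X in X == _]mulnA; apply/eqP.
rewrite [RHS]mulnAC [RHS]mulnC mE -binE -rE; ring.
Qed.

(** Average the signed count of occurrences term by term. The alphabet [A]
    disappears from the result. *)
Lemma probability_subseq {R : realType} {T : eqType} (A t : seq T) :
  uniq A -> uniq t -> {subset t <= A} ->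
  (\sum_(w <- permutations (A ++ A)) (subseq t w)%:R) /
    (size (permutations (A ++ A)))%:R = hit_probability R (size t).
Proof.
move=> uA ut sub; set m := A ++ A.
have P_gt0 : (0 < size (permutations m))%N.
  by rewrite -has_predT; apply/hasP; exists m; rewrite ?mem_permutations.
have P_neq0 : (size (permutations m))%:R != 0 :> R by rewrite pnatr_eq0 -lt0n.
rewrite /hit_probability -sum_doublings_size.
transitivity ((\sum_(s <- doublings t) (-1) ^+ (size s + size t) *
   (\sum_(w <- permutations m) occurrences s w)%:R) /
    (size (permutations m))%:R : R).
  congr (_ / _).
  under [RHS]eq_bigr do rewrite natr_sum big_distrr /=.
  rewrite exchange_big /=; apply: eq_big_seq => w.
  rewrite mem_permutations => eq_w.
  rewrite sum_occurrences_doublings // => x.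
  by rewrite (permP eq_w) count_cat !count_uniq_mem //; case: (x \in A).
rewrite big_distrl big_distrr /=; apply: eq_big_seq => s ds.
have fs : (size s)`!%:R != 0 :> R by rewrite pnatr_eq0 -lt0n fact_gt0.
have := congr1 (fun n => n%:R : R) (sum_occurrences_doubled A t s uA ut sub ds).
rewrite /= !natrM natrX => occE.
rewrite -[RHS](mulfK P_neq0) mulrCA; congr (_ / _).
rewrite -!mulrA; congr (_ * _).
by apply: (mulIf fs); rewrite occE; field.
Qed.

(** * The expectation as a sum of probabilities *)

Lemma sum_ltn_minn (n k : nat) : (\sum_(j < n) (j < k) = minn n k)%N.
Proof.
by elim: n => [|n IHn]; rewrite ?big_ord0 ?big_ord_recr /= ?IHn; lia.
Qed.

(** Prefixes of an initial run are initial runs, so the maximum determines all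
    the lengths that occur. *)
Lemma longest_initial_runP (s : seq nat) (j : nat) :
  subseq (iota 1 j) s = (j <= longest_initial_run s)%N.
Proof.
apply/idP/idP => [sub_j|le_j].
  have lt_j : (j < (size s).+1)%N by rewrite ltnS -(size_iota 1 j) size_subseq.
  exact: (@leq_bigmax_cond _ _ _ (Ordinal lt_j)).
suff : subseq (iota 1 (longest_initial_run s)) s.
  by apply: subseq_trans; rewrite -(subnKC le_j) iotaD prefix_subseq.
have [|i sub_i eq_i] := @eq_bigmax_cond _
    [pred i : 'I_(size s).+1 | subseq (iota 1 i) s] (fun i => nat_of_ord i).
  by apply/card_gt0P; exists ord0; rewrite inE sub0seq.
by rewrite /longest_initial_run eq_i.
Qed.

Lemma longest_initial_run_sum (s : seq nat) (n : nat) :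
  {in s, forall x, x <= n}%N ->
  longest_initial_run s = (\sum_(j < n) subseq (iota 1 j.+1) s)%N.
Proof.
move=> le_n; under eq_bigr do rewrite longest_initial_runP.
rewrite sum_ltn_minn; apply/esym/minn_idPr.
have := leqnn (longest_initial_run s); rewrite -{1}longest_initial_runP.
case: (longest_initial_run s) => // L /mem_subseq sub_L.
by apply/le_n/sub_L; rewrite mem_iota add1n ltnS leqnn.
Qed.

Lemma subseq_map_inj {T U : eqType} (f : T -> U) (s w : seq T) :
  injective f -> subseq (map f s) (map f w) = subseq s w.
Proof.
move=> f_inj; elim: w s => [|y w IHw] [|x s] //=.
by rewrite (inj_eq f_inj) -IHw; case: eqP.
Qed.

(** This makes the expectation an average over [permutations], where words can
    be decomposed letter by letter. *)
Lemma perm_words2 (n : nat) :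
  perm_eq [seq val w | w <- enum (words2 n)]
          (permutations (enum 'I_n ++ enum 'I_n)).
Proof.
have sz : size (enum 'I_n ++ enum 'I_n) = (2 * n)%N.
  by rewrite size_cat size_enum_ord mul2n addnn.
have cnt i : count_mem i (enum 'I_n ++ enum 'I_n) = 2%N.
  by rewrite count_cat !count_uniq_mem ?enum_uniq // mem_enum.
apply: uniq_perm; rewrite ?permutations_uniq //.
  by rewrite (map_inj_uniq val_inj) enum_uniq.
move=> s; rewrite mem_permutations; apply/mapP/idP => [[w + ->]|eq_s].
  rewrite mem_enum inE => /forallP cnt_w; apply/allP => i _ /=.
  by rewrite cnt (eqP (cnt_w i)).
have szs : size s == (2 * n)%N by rewrite (perm_size eq_s) sz.
exists (Tuple szs) => //; rewrite mem_enum inE; apply/forallP => i /=.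
by rewrite (permP eq_s) cnt.
Qed.

(** The shift by one between letters and ordinals is injective, hence the runs
    [1 2 ... j] are the prefixes of [enum 'I_n]. *)
Lemma L12_sum (n : nat) (w : (2 * n).-tuple 'I_n) :
  L12 w = (\sum_(j < n) subseq (take j.+1 (enum 'I_n)) w)%N.
Proof.
rewrite /L12 (longest_initial_run_sum _ n); last first.
  by move=> x /mapP[i _ ->]; exact: ltn_ord.
apply: eq_bigr => j _; congr nat_of_bool.
have f_inj : injective (fun i : 'I_n => i.+1) by move=> i k [] /val_inj.
rewrite -(subseq_map_inj _ _ w f_inj); congr subseq.
rewrite map_take (map_comp S) val_enum_ord -map_take take_iota.
by rewrite (minn_idPl (ltn_ord j)) (iotaDl 1 0).
Qed.

Lemma expected_L12_sum (R : realType) (n : nat) :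
  expected_L12 R n = \sum_(j < n.+1) hit_probability R j - 1.
Proof.
have hit0 : hit_probability R 0 = 1.
  by rewrite /hit_probability mul1r /= fact0 invr1.
rewrite big_ord_recl hit0 addrAC subrr add0r.
rewrite /expected_L12 /uniform_expectation.
rewrite cardE -(size_map val) (perm_size (perm_words2 n)).
pose L (s : seq 'I_n) : R :=
  \sum_(j < n) (subseq (take j.+1 (enum 'I_n)) s)%:R.
have -> : \sum_(w in words2 n) (L12 w)%:R =
    \sum_(s <- permutations (enum 'I_n ++ enum 'I_n)) L s.
  rewrite -(perm_big _ (perm_words2 n)) big_map big_enum /=.
  by apply: eq_bigr => w _; rewrite L12_sum natr_sum.
rewrite exchange_big big_distrl /=; apply: eq_bigr => j _.
rewrite probability_subseq ?take_uniq ?enum_uniq //.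
  by rewrite size_take_min size_enum_ord (minn_idPl (ltn_ord j)).
by move=> i _; rewrite mem_enum.
Qed.

(** * Summing the probabilities *)

Lemma iter_Delta_linear {R : comPzRingType} (f g h : nat -> R) (c : R) j m :
  (forall m, f m = g m + c * h m) ->
  iter j Delta f m = iter j Delta g m + c * iter j Delta h m.
Proof.
move=> fE; elim: j m => [|j IHj] m //=; rewrite /Delta !IHj; ring.
Qed.

(** Substituting the equation for [f] into itself [n] times, [Delta] being
    linear. *)
Lemma iter_Delta_telescope {R : comPzRingType} (f g : nat -> R) (c : R) n :
  (forall m, f m = g m + c * Delta f m) ->
  f 0%N =
    \sum_(j < n) c ^+ j * iter j Delta g 0%N + c ^+ n * iter n Delta f 0%N.
Proof.
move=> fE; elim: n => [|n IHn]; first by rewrite big_ord0 add0r mul1r.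
rewrite {1}IHn big_ord_recr /= -addrA; congr (_ + _).
by rewrite (iter_Delta_linear f g _ c n 0 fE) mulrDr mulrA -exprSr -iterSr.
Qed.

Lemma iter_Delta_le {R : numDomainType} (f b : nat -> R) n m :
  (forall i, `|f i| <= b i) -> (forall i, b i.+1 <= b i) ->
  `|iter n Delta f m| <= 2 ^+ n * b (n + m)%N.
Proof.
move=> fb b_decr; elim: n m => [|n IHn] m; first by rewrite mul1r.
rewrite /= /Delta; apply: le_trans (ler_normB _ _) _.
have -> : 2 ^+ n.+1 * b (n.+1 + m)%N =
  2 ^+ n * b (n + m.+1)%N + 2 ^+ n * b (n + m.+1)%N.
  by rewrite exprS -addSnnS -mulrA mulr_natl mulr2n.
apply: lerD (IHn _) _; apply: le_trans (IHn _) _.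
by rewrite ler_wpM2l ?exprn_ge0 // addnS b_decr.
Qed.

(** The [m]-fold primitive of the constant [1]. *)
Definition divided_power {R : realType} (m : nat) (u : R) : R :=
  u ^+ m / m`!%:R.

(** The [m]-fold primitive, vanishing at [0] for [m > 0], of
    [e ^ u (cos u + sin u)]. The recursion is the differential equation
    [y = y' - y'' / 2] integrated [m + 2] times, the divided power
    accounting for the initial values. *)
Fixpoint iter_primitive {R : realType} (m : nat) (u : R) : R :=
  match m with
  | 0 => expR u * (cos u + sin u)
  | 1 => expR u * sin u
  | (m''.+1 as m').+1 =>
      iter_primitive m' u - (iter_primitive m'' u - divided_power m'' u) / 2
  end.

Lemma is_derive_divided_power {R : realType} (m : nat) (u : R) :
  is_derive u 1 (divided_power m.+1) (divided_power m u).
Proof.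
have -> : @divided_power R m.+1 = (m.+1`!%:R^-1) *: (id ^+ m.+1).
  by apply/funext => x; rewrite /divided_power /GRing.scale /= mulrC exprfctE.
apply: is_derive_eq; rewrite /divided_power factS natrM /GRing.scale /=.
have m1 : m.+1%:R != 0 :> R by rewrite pnatr_eq0.
have fm : m`!%:R != 0 :> R by rewrite pnatr_eq0 -lt0n fact_gt0.
field.
by rewrite fm addrC natr1 m1.
Qed.

Lemma iter_primitiveSS {R : realType} (m : nat) (u : R) :
  iter_primitive m.+2 u =
    iter_primitive m.+1 u - 2^-1 * (iter_primitive m u - divided_power m u).
Proof. by rewrite [2^-1 * _]mulrC. Qed.

Lemma is_derive_iter_primitive {R : realType} (m : nat) (u : R) :
  is_derive u 1 (iter_primitive m.+1) (iter_primitive m u).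
Proof.
suff: is_derive u 1 (iter_primitive m.+1) (iter_primitive m u) /\
      is_derive u 1 (iter_primitive m.+2) (iter_primitive m.+1 u) by case.
elim: m => [|m [IHm IHm1]]; last first.
  split; first exact: IHm1.
  have -> : @iter_primitive R m.+3 =
      iter_primitive m.+2 - 2^-1 *: (iter_primitive m.+1 - divided_power m.+1).
    by apply/funext => x; rewrite iter_primitiveSS.
  have Dm := is_derive_divided_power m u.
  by apply: is_derive_eq; rewrite iter_primitiveSS.
have D1 : is_derive u 1 (@iter_primitive R 1) (iter_primitive 0 u).
  have -> : @iter_primitive R 1 = expR * sin by [].
  by apply: is_derive_eq; rewrite /= /GRing.scale /=; ring.
split; first exact: D1.
have -> : @iter_primitive R 2 =
    iter_primitive 1 - 2^-1 *: (expR * (cos + sin) - cst 1).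
  by apply/funext => x; rewrite iter_primitiveSS /divided_power expr0 divr1.
apply: is_derive_eq; rewrite /= /GRing.scale /=.
by rewrite -[(cos + sin) u]/(cos u + sin u); field.
Qed.

Lemma iter_primitive_at0 {R : realType} (m : nat) :
  iter_primitive m.+1 (0 : R) = 0.
Proof.
suff: iter_primitive m.+1 (0 : R) = 0 /\
      iter_primitive m.+2 (0 : R) = 0 by case.
elim: m => [|m [IHm IHm1]].
  have at0 : iter_primitive 1 (0 : R) = 0 by rewrite /= sin0 mulr0.
  split; first exact: at0.
  rewrite iter_primitiveSS at0 /= /divided_power sin0 cos0 expR0 expr0 divr1.
  by rewrite addr0 mulr1 subrr mulr0 subr0.
split; first exact: IHm1.
rewrite iter_primitiveSS IHm1 IHm /divided_power expr0n /=.
by rewrite mul0r subrr mulr0 subr0.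
Qed.

(** Pointwise comparison of derivatives replaces integration of inequalities. *)
Lemma le_of_derive_le {R : realType} (f g df dg : R -> R) (u : R) :
  0 <= u -> f 0 <= g 0 ->
  (forall x : R, is_derive x 1 f (df x)) ->
  (forall x : R, is_derive x 1 g (dg x)) ->
  {in `[0, u], forall x, df x <= dg x} -> f u <= g u.
Proof.
move=> u_ge0 fg0 Df Dg le_d.
have D (x : R) : is_derive x 1 (g - f) (dg x - df x).
  by have := Df x; have := Dg x => ? ?; apply: is_derive_eq.
have [c c_in /= eq_c] :
    exists2 c, c \in `[0, u] & (g - f) u - (g - f) 0 = (dg c - df c) * (u - 0).
  apply: MVT_segment => //.
  apply: continuous_subspaceT => x; apply: differentiable_continuous.
  by apply/derivable1_diffP; case: (D x).
have d_ge0 : 0 <= (dg c - df c) * (u - 0).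
  by rewrite subr0 mulr_ge0 // subr_ge0 le_d.
have gfE x : (g - f) x = g x - f x by [].
by move: eq_c d_ge0 => <-; rewrite !gfE; lra.
Qed.

(** On [[0, 1]] the function itself is at most [2 e] in absolute value, and each
    primitive raises the divided power by one. *)
Lemma iter_primitive_le {R : realType} (m : nat) (u : R) : 0 <= u <= 1 ->
  `|iter_primitive m u| <= 2 * expR 1 * divided_power m u.
Proof.
elim: m u => [|m IHm] u /andP[u_ge0 u_le1].
  rewrite /divided_power expr0 divr1 mulr1 /= normrM ger0_norm ?expR_ge0 //.
  rewrite [leRHS]mulrC; apply: ler_pM; rewrite ?expR_ge0 ?ler_expR //.
  apply: le_trans (ler_normD _ _) _; rewrite (_ : 2 = 1 + 1) //.
  by apply: lerD; rewrite ler_norml ?cos_le1 ?cos_geN1 ?sin_le1 ?sin_geN1.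
pose g : R -> R := (2 * expR 1) *: divided_power m.+1.
have Dg (x : R) : is_derive x 1 g (2 * expR 1 * divided_power m x).
  by have := is_derive_divided_power m x => ?; apply: is_derive_eq.
have Df (x : R) := is_derive_iter_primitive m x.
have g0 : g 0 = 0.
  rewrite -[g 0]/(2 * expR 1 * divided_power m.+1 0) /divided_power expr0n.
  by rewrite mul0r mulr0.
have in01 (x : R) : x \in `[0, u] -> 0 <= x <= 1.
  by rewrite in_itv /= => /andP[-> /le_trans ->].
rewrite -[leRHS]/(g u) ler_norml; apply/andP; split.
  rewrite lerNl -[X in X <= _]/((- iter_primitive m.+1) u).
  apply: (@le_of_derive_le R (- iter_primitive m.+1) _
    (fun x => - iter_primitive m x) _ u _ _ _ Dg) => //.
  - rewrite g0 /= -[X in X <= _]/(- iter_primitive m.+1 0).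
    by rewrite iter_primitive_at0 oppr0.
  - move=> x /in01/IHm; apply: le_trans; rewrite -normrN; exact: ler_norm.
apply: (@le_of_derive_le R _ _ _ _ u _ _ Df Dg) => //.
  by rewrite g0 iter_primitive_at0.
by move=> x /in01/IHm; apply: le_trans; exact: ler_norm.
Qed.

Lemma iter_primitive1_Delta {R : realType} (m : nat) :
  iter_primitive m 1 = (m`!%:R)^-1 + 2 * Delta (iter_primitive^~ 1) m :> R.
Proof. by rewrite /Delta /= /divided_power expr1n mul1r; field. Qed.

(** The error after [n] terms is [2 ^ n] times a signed combination of [2 ^ n]
    values [G_m 1] with [m >= n], each at most [2 e / n!]. *)
Lemma cvg_sum_hit_probability (R : realType) :
  (fun n => \sum_(j < n) hit_probability R j) @ \oo -->
  expR (1 : R) * (cos 1 + sin 1).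
Proof.
pose err (n : nat) : R := 2 ^+ n * iter n Delta (iter_primitive^~ 1) 0%N.
have sumE n : \sum_(j < n) hit_probability R j = iter_primitive 0 1 - err n.
  have /= -> := @iter_Delta_telescope R _ _ 2 n iter_primitive1_Delta.
  by rewrite addrK.
suff err0 : err @ \oo --> (0 : R).
  under eq_fun do rewrite sumE.
  have -> : expR 1 * (cos 1 + sin 1) = iter_primitive 0 (1 : R) - 0.
    by rewrite subr0.
  by apply: cvgB => //; exact: cvg_cst.
apply/norm_cvg0P.
apply: (@squeeze_cvgr _ _ _ _ (cst 0)
  (fun n => 2 * expR 1 * exp_coeff (4 : R) n)).
- apply: nearW => n; rewrite normr_ge0 /=.
  have := @iter_Delta_le R (iter_primitive^~ 1)
    (fun i => 2 * expR 1 / i`!%:R) n 0.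
  rewrite addn0 => le_iter.
  rewrite /err normrM ger0_norm ?exprn_ge0 //.
  apply: le_trans (ler_wpM2l (exprn_ge0 _ _) (le_iter _ _)) _ => //.
  + move=> i; apply: le_trans (iter_primitive_le _ _ _) _.
      by rewrite ler01 lexx.
    by rewrite /divided_power expr1n mul1r.
  + move=> i; rewrite ler_wpM2l ?mulr_ge0 ?expR_ge0 //.
    rewrite lef_pV2 ?posrE ?ltr0n ?fact_gt0 // ler_nat factS leq_pmull //.
  + rewrite /exp_coeff /= (_ : 4 = 2 * 2) ?exprMn; last by ring.
    rewrite le_eqVlt; apply/orP; left; apply/eqP; ring.
- exact: cvg_cst.
- have -> : 0 = 2 * expR (1 : R) * 0 by rewrite mulr0.
  by apply: cvgM; [exact: cvg_cst|exact: cvg_exp_coeff].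
Qed.

Theorem corollary1p2 (R : realType) :
  (fun n : nat => expected_L12 R n) @ \oo --> expR (1 : R) * (cos 1 + sin 1) - 1.
Proof.
under eq_fun do rewrite expected_L12_sum.
apply: cvgB; last exact: cvg_cst.
rewrite (cvg_shiftS (fun n => \sum_(j < n) hit_probability R j)).
exact: cvg_sum_hit_probability.
Qed.
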